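(* For every prime $p\equiv 3\bmod 4$, there exist infinitely many positive integers $d$ for which there exists a $d$-dimensional SIC over $\mathbb{F}_{p^2}$.
   Context: Let $p\equiv 3\bmod 4$ be prime. Put $K=\mathbb{F}_p$ (over which $t^2+1$ does not split) and $L=K(\mathrm{i})\cong\mathbb{F}_{p^2}$ with $\mathrm{i}^2=-1$. The conjugate of $a+b\mathrm{i}\in L$ ($a,b\in K$) is $\overline{a+b\mathrm{i}}=a-b\mathrm{i}$. For a column vector $x\in L^d$, $x^*$ is its conjugate transpose, and $(x,y)=x^*y$. Definition. Given $a,b,c\in K$ with $a^2\neq b$, and a set $X$ of cardinality $d^2$, a tuple $\{x_i\}_{i\in X}$ of vectors $x_i\in L^d$ forms an $(a,b,c)$-SIC if: (a) $(x_i,x_i)=a$ for all $i\in X$; (b) $(x_i,x_j)(x_j,x_i)=b$ for all $i,j\in X$ with $i\neq j$; (c) $\sum_{i\in X}x_ix_i^*=cI$, where $I$ is the $d\times d$ identity matrix; and (d) $\operatorname{span}\{x_i:i\in X\}=L^d$. A $d$-dimensional SIC over $\mathbb{F}_{p^2}$ is an $(a,b,c)$-SIC in $L^d$ with $L=\mathbb{F}_{p^2}$, for some $a,b,c\in K=\mathbb{F}_p$ with $a^2\neq b$. *)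

(* Defs.v *)
From HB Require Import structures.
From mathcomp Require Import all_boot all_order all_algebra all_field.

Set Implicit Arguments.
Unset Strict Implicit.
Unset Printing Implicit Defensive.

Import GRing.Theory.
Local Open Scope ring_scope.

Section SIC.

Variables (K : fieldType) (L : fieldExtType K) (im : L).

(* The conjugate a - b im of z = a + b im, where a and b are the coordinates
   of z in the K-basis (1, im) of L; see [conjLE].  Meaningful when (1, im)
   is a basis of L, as is the case when L = K(im), im ^ 2 = -1 and -1 is not
   a square in K. *)
Definition conjL (z : L) : L :=
  (coord [tuple 1; im] ord0 z)%:A - coord [tuple 1; im] ord_max z *: im.

Definition conj_trmx m n (A : 'M[L]_(m, n)) : 'M[L]_(n, m) :=
  (map_mx conjL A)^T.

Definition inner d (x y : 'cV[L]_d) : L := (conj_trmx x *m y) ord0 ord0.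

(* The scalars a, b, c of K are seen in L through k |-> k%:A. *)
Definition is_abcSIC (a b c : K) (d : nat) (X : finType)
    (x : X -> 'cV[L]_d) : Prop :=
  [/\ #|X| = (d ^ 2)%N & a ^+ 2 <> b] /\
  [/\ forall i, inner (x i) (x i) = a%:A,
      forall i j, i <> j -> inner (x i) (x j) * inner (x j) (x i) = b%:A,
      \sum_(i : X) x i *m conj_trmx (x i) = (c%:A)%:M
    & <<[seq x i | i : X]>>%VS = fullv].

Definition has_SIC (d : nat) : Prop :=
  exists (a b c : K) (X : finType) (x : X -> 'cV[L]_d), is_abcSIC a b c x.

Lemma conjLE (a b : K) :
  (forall k : K, k ^+ 2 <> -1) -> im ^+ 2 = -1 ->
  conjL (a%:A + b *: im) = a%:A - b *: im.
Proof.
move=> nosq im2.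
have fr : free [tuple 1; im].
  rewrite /= free_cons span_seq1 (seq1_free im); apply/andP; split; last first.
    by apply/eqP => im0; move/eqP: im2; rewrite im0 expr0n eq_sym oppr_eq0 oner_eq0.
  apply/vlineP => -[k Dk].
  have k0 : k != 0.
    by apply/eqP => k0; move/eqP: Dk; rewrite k0 scale0r oner_eq0.
  have Dim : im = k^-1%:A by rewrite Dk scalerA mulVf // scale1r.
  apply: (nosq k^-1); apply: (fmorph_inj (in_alg L)).
  by rewrite rmorphXn rmorphN rmorph1 /= -Dim.
have -> : a%:A + b *: im =
    \sum_(i < 2) (if i == ord0 then a else b) *: [tuple 1; im]`_i.
  by rewrite big_ord_recl big_ord1.
by rewrite /conjL !coord_sum_free.
Qed.

End SIC.

Lemma Fp_nosqrtN1 (p : nat) (k : 'F_p) :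
  prime p -> p = 3 %[mod 4] -> k ^+ 2 <> -1.
Proof.
move=> p_pr p34 k2.
have Dp : p = (4 * (p %/ 4) + (2 + 1))%N by rewrite {1}(divn_eq p 4) p34 mulnC.
have k4 q : k ^+ (4 * q + (2 + 1)) = - k.
  by rewrite exprD (exprM k 4) (exprM k 2 2) k2 sqrrN !expr1n mul1r exprD k2 mulN1r.
have : k ^+ p = - k by rewrite -(k4 (p %/ 4)%N); congr (_ ^+ _).
have := expf_card k; rewrite card_Fp // => ->.
move/eqP; rewrite -subr_eq0 opprK -mulr2n -mulr_natr mulf_eq0.
case/orP => [/eqP k0|]; first by move/eqP: k2; rewrite k0 expr0n eq_sym oppr_eq0 oner_eq0.
rewrite -(dvdn_pcharf (pchar_Fp p_pr)) => /dvdn_leq -/(_ isT) p2.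
by move: p p2 p_pr p34 {k k2 k4 Dp} => [|[|[|]]].
Qed.

(* The fields K(im) with im ^ 2 = -1 exist over K = F_p, p = 3 mod 4. *)
Lemma ex_Fp_im (p : nat) :
  prime p -> p = 3 %[mod 4] ->
  exists (L : fieldExtType 'F_p) (im : L),
    im ^+ 2 = -1 /\ <<1; im>>%VS = fullv.
Proof.
move=> p_pr p34.
have sz : size ('X^2 + 1 : {poly 'F_p}) = 3 by rewrite size_XnaddC.
have irr : irreducible_poly ('X^2 + 1 : {poly 'F_p}).
  apply: cubic_irreducible; first by rewrite sz.
  move=> k; rewrite /root !hornerE; apply/negP; rewrite addr_eq0 => /eqP.
  exact: Fp_nosqrtN1.
have [L _ [im rim im_gen]] := irredp_FAdjoin irr.
exists L, im; split=> //; move: rim.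
by rewrite /root rmorphD /= map_polyXn rmorph1 !hornerE addr_eq0 => /eqP.
Qed.

(* Main.v *)
Require Import Defs.
From mathcomp Require Import all_boot all_order all_algebra all_field.
From mathcomp Require Import ring.

Set Implicit Arguments.
Unset Strict Implicit.
Unset Printing Implicit Defensive.

Import GRing.Theory.
Local Open Scope ring_scope.

(** The Hoggar lines are a SIC in dimension 8: the orbit of the vector
    (-1 + 2i, 1, ..., 1) under the Weyl-Heisenberg group of (Z/2)^3, i.e. under
    translations and modulations by characters.  For (Z/2)^k the orbit of the
    same shape of vector in dimension d = 2^k has inner products that are, up
    to sign, polynomial expressions in i with integer coefficients depending
    only on the residue class of d, and they are equiangular as soon as d = 8
    in the field.  In characteristic p this equality is a congruence, and
    Fermat's little theorem provides infinitely many solutions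
    k = 3 + (p - 1) * N.

    Up to sign, the inner products are values of the twisted autocorrelation of the
    fiducial vector, computed in closed form in [autocorrelation]; tightness
    ([weyl_orbit_tight]) and spanning ([weyl_orbit_span]) hold for the orbit by
    orthogonality of characters ([sum_chi]); [hoggar_SIC] specializes the
    closed form to d = 8 and finds a = 12, b = 16, c = 96. *)

(** * Sign characters of elementary abelian 2-groups *)

Section Characters.

Variables (R : idomainType) (n : nat).
Local Notation G := 'rV['F_2]_n.
Implicit Types u v w : G.

(** The bicharacter (-1)^(w . v): the entries at v of the diagonal Weyl
    operator indexed by w. *)
Definition chi w v : R := (-1) ^+ nat_of_ord ((w *m v^T) 0 0).

Lemma chiC w v : chi w v = chi v w.
Proof.
rewrite /chi; congr (_ ^+ nat_of_ord _).
by rewrite !mxE; apply: eq_bigr => i _; rewrite !mxE mulrC.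
Qed.

Lemma chiDr w u v : chi w (u + v) = chi w u * chi w v.
Proof.
rewrite /chi linearD mulmxDr mxE -exprD.
move: (_ 0 0) (_ 0 0) => a b.
by rewrite -signr_odd -[RHS]signr_odd /= modn2 oddb.
Qed.

Lemma chiDl u v w : chi (u + v) w = chi u w * chi v w.
Proof. by rewrite ![chi _ w]chiC chiDr. Qed.

Lemma chi0 v : chi 0 v = 1.
Proof. by rewrite /chi mul0mx mxE. Qed.

Lemma addvv v : v + v = 0.
Proof. by apply/matrixP => i j; rewrite !mxE -mulr2n -mulr_natr pchar_Fp_0 ?mulr0. Qed.

Lemma addvK u v : u + v + v = u.
Proof. by rewrite -addrA addvv addr0. Qed.

Lemma addv_eq0 u v : (u + v == 0) = (u == v).
Proof. by rewrite -(inj_eq (addIr v)) addvK add0r. Qed.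

Lemma chi_sqr w v : chi w v * chi w v = 1.
Proof. by rewrite -chiDr addvv chiC chi0. Qed.

Lemma sum_chi w : (2 : R) != 0 ->
  \sum_v chi w v = if w == 0 then #|{: G}|%:R else 0.
Proof.
move=> two_neq0; case: eqP => [-> | /eqP/rV0Pn[i wi_neq0]].
  by rewrite (eq_bigr _ (fun v _ => chi0 v)) sumr_const.
(* Translating by a basis vector on which w is nonzero flips every sign, so
   the sum is its own opposite. *)
have chi_i : chi w (delta_mx 0 i) = -1.
  rewrite /chi trmx_delta -colE mxE.
  by case: (w 0 i) wi_neq0 => [[|[|]]].
have : \sum_v chi w v = - \sum_v chi w v.
  rewrite {1}(reindex_inj (addIr (delta_mx 0 i))) -sumrN.
  by apply: eq_bigr => v _; rewrite chiDr chi_i mulrN1.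
move/eqP; rewrite -subr_eq0 opprK -mulr2n -mulr_natl mulf_eq0 (negPf two_neq0).
by move/eqP.
Qed.

End Characters.

(** * Autocorrelation of the fiducial vector *)

Section Fiducial.

Variables (R : idomainType) (n : nat).
Local Notation G := 'rV['F_2]_n.
Implicit Types (y z : R) (u v w : G).

(** The vector (1 + y, 1, ..., 1).  Writing it as the all-one vector plus a
    multiple of a basis vector is what makes its autocorrelation a closed
    formula. *)
Definition fiducial y v : R := 1 + (v == 0)%:R * y.

(** Expanding the product of the two fiducials leaves a full character sum,
    two point masses at 0 and u, and their overlap.  The role of z is that of
    the conjugate of y. *)
Lemma autocorrelation y z u w : (2 : R) != 0 ->
  \sum_v chi R w v * (fiducial z v * fiducial y (v + u)) =
    (w == 0)%:R * #|{: G}|%:R + z + chi R w u * y + (u == 0)%:R * (z * y).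
Proof.
move=> two_neq0.
have pick (F : G -> R) a : \sum_v (v == a)%:R * F v = F a.
  rewrite (bigD1 a) //= eqxx mul1r big1 ?addr0 // => v /negPf->.
  by rewrite mul0r.
transitivity (\sum_v chi R w v + \sum_v (v == 0)%:R * (chi R w v * z) +
    \sum_v (v == u)%:R * (chi R w v * y) +
    \sum_v (v == 0)%:R * (chi R w v * (v == u)%:R * (z * y))).
  rewrite -!big_split /=; apply: eq_bigr => v _.
  by rewrite /fiducial addv_eq0; ring.
rewrite !pick (sum_chi _ two_neq0) [chi R w 0]chiC chi0 !mul1r [0 == u]eq_sym.
by case: (w == 0); rewrite ?mul1r ?mul0r.
Qed.

End Fiducial.

(** * The Weyl-Heisenberg orbit *)

Section Conjugation.

Variables (K : fieldType) (L : fieldExtType K) (im : L).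

Lemma conjLD : {morph conjL im : x y / x + y}.
Proof. by move=> x y; rewrite /conjL !raddfD /= !scalerDl; ring. Qed.

Lemma conjLN : {morph conjL im : x / - x}.
Proof. by move=> x; rewrite /conjL !raddfN /= !scaleNr; ring. Qed.

Lemma conjL_chi n (w v : 'rV['F_2]_n) x :
  conjL im (chi L w v * x) = chi L w v * conjL im x.
Proof.
rewrite /chi -signr_odd; case: (odd _); rewrite ?expr1 ?expr0 ?mul1r //.
by rewrite !mulN1r conjLN.
Qed.

End Conjugation.

Section WeylOrbit.

Variables (K : fieldType) (L : fieldExtType K) (im : L) (n : nat).
Local Notation G := 'rV['F_2]_n.
Implicit Types (y z : L) (u v w : G) (i j : G * G).

(** Coordinates are indexed through the enumeration of the group, so that
    the dimension is its order; the component i.1 translates and i.2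
    modulates. *)
Definition weyl_orbit y i : 'cV[L]_#|{: G}| :=
  \col_k (chi L i.2 (enum_val k) * fiducial y (enum_val k + i.1)).

Lemma sum_enum_val (F : G -> L) :
  \sum_(k < #|{: G}|) F (enum_val k) = \sum_v F v.
Proof. by rewrite -big_enum_val; apply: eq_bigl. Qed.

Lemma conjL_fiducial y z v : conjL im 1 = 1 -> conjL im y = z ->
  conjL im (fiducial y v) = fiducial z v.
Proof.
move=> conj1 conjy; rewrite /fiducial.
by case: eqP; rewrite ?mul1r ?mul0r ?addr0 // conjLD conj1 conjy.
Qed.

(** Relative to the translation by i.1, the inner product is an
    autocorrelation at the difference of the two group elements; as the group
    has exponent 2, this difference is i + j. *)
Lemma inner_weyl_orbit y z i j : (2 : L) != 0 ->
  conjL im 1 = 1 -> conjL im y = z ->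
  let u := i.1 + j.1 in let w := i.2 + j.2 in
  inner im (weyl_orbit y i) (weyl_orbit y j) =
    chi L w i.1 * ((w == 0)%:R * #|{: G}|%:R + z + chi L w u * y
                   + (u == 0)%:R * (z * y)).
Proof.
move=> two_neq0 conj1 conjy u w; rewrite /inner mxE.
transitivity (\sum_v chi L w v * (fiducial z (v + i.1) * fiducial y (v + j.1))).
  rewrite -sum_enum_val; apply: eq_bigr => k _; rewrite !mxE conjL_chi.
  by rewrite (conjL_fiducial _ conj1 conjy) /w chiDl; ring.
rewrite (reindex_inj (addIr i.1)) -autocorrelation // mulr_sumr.
apply: eq_bigr => v _; rewrite chiDr addvK /u addrA.
by ring.
Qed.

(** The (s, t) entry contains the sum over w of chi w (s + t), which kills
    everything off the diagonal; on the diagonal the translations average the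
    fiducial. *)
Lemma weyl_orbit_tight y z : (2 : L) != 0 ->
  conjL im 1 = 1 -> conjL im y = z ->
  \sum_i weyl_orbit y i *m conj_trmx im (weyl_orbit y i) =
    (#|{: G}|%:R * \sum_(v : G) fiducial y v * fiducial z v)%:M.
Proof.
move=> two_neq0 conj1 conjy; apply/matrixP => k l.
rewrite summxE !mxE.
set s := enum_val k; set t := enum_val l.
transitivity (\sum_w \sum_u
    chi L w (s + t) * (fiducial y (s + u) * fiducial z (t + u))).
  rewrite exchange_big pair_big; apply: eq_bigr => -[u w] _ /=.
  rewrite !mxE big_ord1 !mxE conjL_chi (conjL_fiducial _ conj1 conjy) /=.
  by rewrite chiDr; ring.
rewrite exchange_big /=; under eq_bigr do
  rewrite -mulr_suml (eq_bigr _ (fun w _ => chiC L w _)) (sum_chi _ two_neq0).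
rewrite addv_eq0 (inj_eq enum_val_inj) {}/s {}/t.
case: (altP (k =P l)) => [<-|_]; last by rewrite big1 // => u _; rewrite mul0r.
rewrite mulr1n -mulr_sumr; congr (_ * _).
by rewrite [RHS](reindex_inj (addrI (enum_val k))).
Qed.

End WeylOrbit.

(** The frame constant may vanish (for the Hoggar fiducial it is 96, which is
    0 in characteristic 3), so
    spanning does not follow from tightness.  Instead, Fourier inversion over
    the modulations isolates a single coordinate of a translated fiducial, and
    the translation is chosen so that this coordinate is 1. *)
Lemma weyl_orbit_span (K : fieldType) (L : fieldExtType K) n (y : L) :
  (2 : L) != 0 ->
  <<[seq weyl_orbit y i | i : 'rV['F_2]_n.+1 * 'rV['F_2]_n.+1]>>%VS = fullv.
Proof.
move=> two_neq0; apply/eqP; rewrite eqEsubv subvf; apply/subvP => x _.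
have card_neq0 : (#|{: 'rV['F_2]_n.+1}|%:R : L) != 0.
  by rewrite card_mx card_Fp // natrX expf_neq0.
have delta_in k : delta_mx k 0 \in
    <<[seq weyl_orbit y i | i : 'rV['F_2]_n.+1 * 'rV['F_2]_n.+1]>>%VS.
  pose s := enum_val k; pose u := s + const_mx 1.
  have -> : delta_mx k 0 =
      \sum_w (#|{: 'rV['F_2]_n.+1}|%:R^-1 * chi L w s) *: weyl_orbit y (u, w).
    apply/colP => l; rewrite summxE !mxE eqxx andbT.
    transitivity (#|{: 'rV['F_2]_n.+1}|%:R^-1 *
        ((\sum_w chi L (s + enum_val l) w) * fiducial y (enum_val l + u))).
      rewrite (sum_chi _ two_neq0) addv_eq0 (inj_eq enum_val_inj) [k == l]eq_sym.
      case: eqP => [->|_]; last by rewrite mul0r mulr0.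
      rewrite mulKf // /fiducial /u addrA addvv add0r.
      have /negPf-> : (const_mx 1 : 'rV['F_2]_n.+1) != 0.
        by apply/eqP => /rowP/(_ 0); rewrite !mxE.
      by rewrite mul0r addr0.
    rewrite mulr_suml mulr_sumr; apply: eq_bigr => w _; rewrite !mxE /=.
    by rewrite chiC chiDr; ring.
  apply: memv_suml => w _; apply: memvZ; apply: memv_span.
  by apply: map_f; rewrite mem_enum.
rewrite [x]matrix_sum_delta; apply: memv_suml => k _.
by rewrite big_ord1; apply: memvZ.
Qed.

(** * The finite field analogues of the Hoggar lines *)

Lemma nosqrtN1_two_neq0 (K : fieldType) :
  (forall k : K, k ^+ 2 <> -1) -> (2 : K) != 0.
Proof.
move=> nosq; apply/eqP => two0; apply: (nosq 1); rewrite expr1n.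
by apply/eqP; rewrite -subr_eq0 opprK -two0.
Qed.

(** The constant y = -2 + 2 im is the one for which the first entry 1 + y of
    the fiducial is that of the Hoggar lines.  With z its conjugate,
    z + y = -4, z - y = -4 im and z * y = 8, so the autocorrelation is 12 at
    the origin and, away from it, a value A among 4, -4 and -4 im.  The two
    inner products of a pair of vectors multiply to chi w u * A ^ 2, and
    A = -4 im exactly when chi w u = -1, so they always multiply to 16.  The condition a ^ 2 <> b holds
    as 12 ^ 2 - 16 = 2 ^ 7. *)
Lemma hoggar_SIC (K : fieldType) (L : fieldExtType K) (im : L) n :
  (forall k : K, k ^+ 2 <> -1) -> im ^+ 2 = -1 ->
  (2 ^ n.+1)%:R = 8 :> K -> has_SIC im (2 ^ n.+1).
Proof.
move=> nosq im2 d8.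
have two_neq0 := nosqrtN1_two_neq0 nosq.
have two_neq0L : (2 : L) != 0 by rewrite -(rmorph_nat (in_alg L)) fmorph_eq0.
have cardG : #|{: 'rV['F_2]_n.+1}| = (2 ^ n.+1)%N by rewrite card_mx card_Fp // mul1n.
have d8L : (#|{: 'rV['F_2]_n.+1}|%:R : L) = 8.
  by rewrite cardG -(rmorph_nat (in_alg L)) d8 rmorph_nat.
have conj1 : conjL im 1 = 1.
  by have := conjLE 1 0 nosq im2; rewrite !scale0r !scale1r subr0 addr0.
pose y : L := -2 + 2 * im; pose z : L := -2 - 2 * im.
have conjy : conjL im y = z.
  have := conjLE (-2) 2 nosq im2.
  by rewrite scaleNr !scaler_nat -[im *+ 2]mulr_natl.
have zy : z * y = 8 by rewrite /z /y; ring: im2.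
rewrite -cardG.
exists 12, 16, 96, ('rV['F_2]_n.+1 * 'rV['F_2]_n.+1)%type, (weyl_orbit y).
split; split.
- by rewrite card_prod mulnn.
- move/eqP; rewrite -subr_eq0.
  have -> : (12 : K) ^+ 2 - 16 = 2 ^+ 7 by ring.
  by rewrite expf_eq0 (negPf two_neq0).
- move=> [u w]; rewrite (inner_weyl_orbit _ _ two_neq0L conj1 conjy) /= !addvv.
  rewrite eqxx !chi0 d8L zy /y /z scaler_nat /= !mul1r; ring.
- move=> [u1 w1] [u2 w2] neq_ij.
  rewrite !(inner_weyl_orbit _ _ two_neq0L conj1 conjy) /=.
  rewrite [u2 + u1]addrC [w2 + w1]addrC d8L zy scaler_nat.
  set u := u1 + u2; set w := w1 + w2; set A := (_ + _ : L).
  transitivity (chi L w u * A ^+ 2); first by rewrite chiDr; ring.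
  rewrite {}/A.
  case: (eqVneq w 0) => [w0|_].
    have /negPf-> : u != 0.
      apply/eqP => u0; case: neq_ij; congr (_, _); apply/eqP.
        by rewrite -addv_eq0 -/u u0.
      by rewrite -addv_eq0 -/w w0.
    by rewrite w0 chi0 /y /z /= !mul1r; ring: im2.
  case: (eqVneq u 0) => [->|_].
    by rewrite chiC chi0 /y /z /= !mul1r; ring: im2.
  have : (chi L w u - 1) * (chi L w u + 1) = 0.
    transitivity (chi L w u * chi L w u - 1); first by ring.
    by rewrite chi_sqr subrr.
  move/eqP; rewrite mulf_eq0 subr_eq0 addr_eq0 /y /z.
  by case/orP => /eqP-> /=; ring: im2.
- rewrite (weyl_orbit_tight _ two_neq0L conj1 conjy) d8L.
  have -> : \sum_(v : 'rV_n.+1) fiducial y v * fiducial z v = 12.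
    transitivity (\sum_(v : 'rV_n.+1)
        chi L 0 v * (fiducial z v * fiducial y (v + 0))).
      by apply: eq_bigr => v _; rewrite chi0 addr0; ring.
    rewrite autocorrelation // !eqxx chi0 d8L zy /y /z /= !mul1r; ring.
  by congr (_%:M); rewrite scaler_nat; ring.
- exact: weyl_orbit_span.
Qed.

Theorem corollary6 (p : nat) (p_pr : prime p) (p_mod4 : p = 3 %[mod 4])
    (L : fieldExtType 'F_p) (im : L) (im_sq : im ^+ 2 = -1)
    (L_gen : <<1; im>>%VS = fullv) :
  forall N : nat, exists d : nat, (N < d)%N /\ has_SIC im d.
Proof.
move=> N.
have nosq (k : 'F_p) : k ^+ 2 <> -1 by apply: Fp_nosqrtN1.
have two_neq0 := nosqrtN1_two_neq0 nosq.
(* The exponent is 3 + (p - 1) * N: by Fermat the dimension is 8 modulo p. *)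
exists (2 ^ (2 + p.-1 * N).+1)%N; split.
  apply: leq_trans (ltn_expl N (isT : 1 < 2)%N) _; rewrite leq_exp2l //.
  by rewrite leqW // (leq_trans _ (leq_addl _ _)) // leq_pmull // -subn1 subn_gt0 prime_gt1.
apply: hoggar_SIC => //.
have fermat : (2 : 'F_p) ^+ p.-1 = 1.
  apply: (mulfI two_neq0); rewrite mulr1 -exprS prednK ?prime_gt0 //.
  by have := expf_card (2 : 'F_p); rewrite card_Fp.
by rewrite natrX -addSn exprD exprM fermat expr1n mulr1 -natrX.
Qed.
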